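(* Let $\lambda\in\mathbb R\setminus\{0\}$, let $n>1$, let $Q_1,Q_2$ be non-zero real homogeneous polynomials of degree $n$, and consider the system $\dot x=\lambda x+Q_1(x,y)$, $\dot y=\lambda y+Q_2(x,y)$. There are infinitely many equilibria of the system at infinity if and only if $yQ_1(x,y)=xQ_2(x,y)$ (as polynomials). Moreover, in this case either there are also infinitely many finite equilibria or the only finite equilibrium is the origin.
   Context: The system extends to the circle at infinity by the Poincaré compactification. In the chart $U_1$ (with $(x,y)=(1/v,u/v)$) it is $\dot u=F(u)$, $\dot v=-\lambda v^n-vQ_1(1,u)$ with $F(u)=Q_2(1,u)-uQ_1(1,u)$; in the chart $U_2$ (with $(x,y)=(u/v,1/v)$) it is $\dot u=G(u)$, $\dot v=-\lambda v^n-vQ_2(u,1)$ with $G(u)=Q_1(u,1)-uQ_2(u,1)$; in the antipodal charts $V_1,V_2$ the expressions are those of $U_1,U_2$ multiplied by $(-1)^{n-1}$. The circle at infinity is $v=0$. Equilibria at infinity are the equilibria $(u,0)$ on this circle; finite equilibria are equilibria in $\mathbb R^2$. *)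

(* Defs.v *)
From HB Require Import structures.
From mathcomp Require Import all_boot all_order all_algebra.
From mathcomp Require Import mpoly.
From mathcomp Require Import boolp classical_sets cardinality reals.
Set Implicit Arguments.
Unset Strict Implicit.
Unset Printing Implicit Defensive.
Import Order.TTheory GRing.Theory Num.Theory.
Local Open Scope classical_set_scope.
Local Open Scope ring_scope.

Definition eval2 (R : realType) (Q : {mpoly R[2]}) (x y : R) : R :=
  Q.@[fun i : 'I_2 => if i == 0 then x else y].

Definition planar_field (R : realType) : Type := R * R -> R * R.

Definition equilibria (R : realType) (X : planar_field R) : set (R * R) :=
  [set p | X p = (0, 0)].

Definition hsystem (R : realType) (lam : R) (Q1 Q2 : {mpoly R[2]}) :
    planar_field R :=
  fun p => (lam * p.1 + eval2 Q1 p.1 p.2, lam * p.2 + eval2 Q2 p.1 p.2).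

Definition poincare_F (R : realType) (Q1 Q2 : {mpoly R[2]}) (u : R) : R :=
  eval2 Q2 1 u - u * eval2 Q1 1 u.

Definition poincare_G (R : realType) (Q1 Q2 : {mpoly R[2]}) (u : R) : R :=
  eval2 Q1 u 1 - u * eval2 Q2 u 1.

(* (x, y) in the plane corresponds to the two points of the sphere on the line
   through the origin and (x, y, 1), so that x = z1 / z3 and y = z2 / z3. *)
Definition sphere (R : realType) : set (R * R * R) :=
  [set z | z.1.1 ^+ 2 + z.1.2 ^+ 2 + z.2 ^+ 2 = 1].

Definition circle_at_infinity (R : realType) : set (R * R * R) :=
  [set z | sphere z /\ z.2 = 0].

(* The charts that meet the circle at infinity; the remaining two, z3 > 0 and
   z3 < 0, contain only the copies of the finite points. *)
Inductive chart : Set := U1 | U2 | V1 | V2.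

Definition chart_dom (R : realType) (c : chart) : set (R * R * R) :=
  match c with
  | U1 => [set z | sphere z /\ 0 < z.1.1]
  | U2 => [set z | sphere z /\ 0 < z.1.2]
  | V1 => [set z | sphere z /\ z.1.1 < 0]
  | V2 => [set z | sphere z /\ z.1.2 < 0]
  end.

(* The coordinates (u, v), where (x, y) = (1/v, u/v) in U1 and V1, and
   (x, y) = (u/v, 1/v) in U2 and V2. *)
Definition chart_coord (R : realType) (c : chart) (z : R * R * R) : R * R :=
  match c with
  | U1 | V1 => (z.1.2 / z.1.1, z.2 / z.1.1)
  | U2 | V2 => (z.1.1 / z.1.2, z.2 / z.1.2)
  end.

(* The chart expressions of the Poincare compactification of
   [hsystem lam Q1 Q2] for Q1, Q2 homogeneous of degree n, obtained by
   multiplying the pushed-forward field by v ^+ n.-1. The sign in V1 and V2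
   comes from z3 ^+ n.-1 being the global factor on the sphere. *)
Definition chart_field (R : realType) (lam : R) (n : nat)
    (Q1 Q2 : {mpoly R[2]}) (c : chart) : planar_field R :=
  let X1 (p : R * R) := (poincare_F Q1 Q2 p.1,
                         - lam * p.2 ^+ n - p.2 * eval2 Q1 1 p.1) in
  let X2 (p : R * R) := (poincare_G Q1 Q2 p.1,
                         - lam * p.2 ^+ n - p.2 * eval2 Q2 p.1 1) in
  let s : R := (-1) ^+ n.-1 in
  match c with
  | U1 => X1
  | U2 => X2
  | V1 => fun p => (s * (X1 p).1, s * (X1 p).2)
  | V2 => fun p => (s * (X2 p).1, s * (X2 p).2)
  end.

(* Vanishing does not depend on the chart, and the four domains cover the
   circle at infinity, so "in every chart" and "in some chart" agree. *)
Definition equilibria_at_infinity (R : realType) (lam : R) (n : nat)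
    (Q1 Q2 : {mpoly R[2]}) : set (R * R * R) :=
  [set z | circle_at_infinity z /\
           forall c : chart, chart_dom c z ->
             equilibria (chart_field lam n Q1 Q2 c) (chart_coord c z)].

(* Main.v *)
Require Import Defs.
From HB Require Import structures.
From mathcomp Require Import all_boot all_order all_algebra.
From mathcomp Require Import mpoly.
From mathcomp Require Import boolp classical_sets cardinality reals.
From mathcomp Require Import polyrcf ring lra.
Set Implicit Arguments.
Unset Strict Implicit.
Unset Printing Implicit Defensive.
Import Order.TTheory GRing.Theory Num.Theory.
Local Open Scope classical_set_scope.
Local Open Scope ring_scope.

(** Everything is governed by the binary form W = y Q1 - x Q2, homogeneous of
    degree n+1 ([crossform]), which measures how far the nonlinear part of the
    field is from being radial.

    By homogeneity, the restrictions F and G of the compactified field to the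
    circle at infinity are, up to sign, W dehomogenized at x = 1 and at y = 1;
    hence the equilibria at infinity are exactly the zeros of W on the unit
    circle ([equilibria_at_infinityE]).  If W = 0 this is the whole circle.  If
    W is not zero, then W(1, u) is a nonzero polynomial in u, so it has finitely
    many roots; the lines through the origin with these slopes, together with
    the y-axis, meet the circle in finitely many points
    ([finite_circle_zeros]).

    When W = 0 the field is radial, so the two equilibrium equations on a line
    of slope u, parametrized by (t, t u) with t <> 0, collapse to the single
    equation lam + t^(n-1) Q1(1, u) = 0.  If it is solvable for one slope u0,
    then Q1(1, u0) is nonzero, and Q1(1, u) keeps its sign for u near u0; the
    solution t0 can then be rescaled by a positive (n-1)-th root to a solution
    of slope u ([infinite_ray_directions]).  So one nonzero equilibrium that is
    not on the y-axis forces infinitely many, and exchanging the coordinates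
    handles the y-axis. *)

(** * Infinite sets and roots in the reals *)

Lemma infinite_sub_image (T U : Type) (f : T -> U) (A : set T) (B : set U) :
  B `<=` f @` A -> infinite_set B -> infinite_set A.
Proof. by move=> BA Binf Afin; apply/Binf/(sub_finite_set BA)/finite_image. Qed.

Lemma infinite_ball (R : realType) (x d : R) :
  0 < d -> infinite_set [set u : R | `|u - x| < d].
Proof.
move=> d0.
(* The points x + d / (k + 2) are in the ball; the map recovers k from them. *)
apply: (@infinite_sub_image _ _ (fun u => (Num.truncn (d / (u - x))).-2) _ setT);
  last exact: infinite_nat.
move=> k _; have k2 : 0 < (k.+2%:R : R) by rewrite ltr0n.
exists (x + d / k.+2%:R).
  rewrite /= addrC addKr gtr0_norm ?divr_gt0 // ltr_pdivrMr //.
  by rewrite ltr_pMr // ltr1n.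
rewrite addrC addKr invfM invrK mulrA divff ?gt_eqF // mul1r.
by rewrite natrK.
Qed.

Arguments infinite_ball [R] x [d].

Lemma infinite_realType (R : realType) : infinite_set [set: R].
Proof. exact: sub_infinite_set (infinite_ball 0 ltr01). Qed.

Lemma nth_root_exists (R : rcfType) (k : nat) (c : R) :
  (0 < k)%N -> 0 < c -> exists2 r : R, 0 < r & r ^+ k = c.
Proof.
move=> k0 c0; have c1 : 1 <= c + 1 by rewrite lerDr ltW.
have c10 : 0 <= c + 1 by exact: le_trans ler01 c1.
have sgn : ('X^k - c%:P).[0] <= 0 <= ('X^k - c%:P).[c + 1].
  rewrite !hornerE expr0n gtn_eqF //= sub0r oppr_le0 (ltW c0) /= subr_ge0.
  by apply: le_trans (ler_eXnr k0 c1); rewrite lerDl ler01.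
have [r /andP[r0 _]] := Num.Theory.poly_ivt c10 sgn.
rewrite /root !hornerE subr_eq0 => /eqP rc; exists r => //.
rewrite lt_def r0 andbT; apply: contraTneq c0 => rE.
by rewrite -rc rE expr0n gtn_eqF //= ltxx.
Qed.

(** The sign of [q] at [u0] persists nearby, so for [u] close to [u0] the
    quotient of [q.[u0]] by [q.[u]] is positive and has a positive [k]-th root
    [r]; then [t0 * r] solves the equation for [u].  Since [lam] is nonzero,
    neither [t0] nor [q.[u0]] can vanish. *)
Lemma infinite_ray_directions (R : realType) (lam : R) (k : nat)
    (q : {poly R}) (t0 u0 : R) :
  (0 < k)%N -> lam != 0 -> lam + t0 ^+ k * q.[u0] = 0 ->
  infinite_set [set u | exists2 t : R, t != 0 & lam + t ^+ k * q.[u] = 0].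
Proof.
move=> k0 lam0 eq0.
have q0 : q.[u0] != 0.
  by apply: contraNneq lam0 => qE; move/eqP: eq0; rewrite qE mulr0 addr0.
have t00 : t0 != 0.
  apply: contraNneq lam0 => tE; move/eqP: eq0.
  by rewrite tE expr0n gtn_eqF //= mul0r addr0.
have [d d0 near_u0] := poly_cont u0 q (etrans (normr_gt0 _) q0).
apply: (sub_infinite_set _ (infinite_ball u0 d0)) => u /= /near_u0 qu.
have c0 : 0 < q.[u0] / q.[u].
  move: (q0) qu; rewrite neq_lt => /orP[u0n|u0p].
    rewrite (ltr0_norm u0n) ltr_norml => /andP[_ ?].
    by rewrite nmulr_lgt0 // invr_lt0; lra.
  rewrite (gtr0_norm u0p) ltr_norml => /andP[? _].
  by apply: divr_gt0 => //; lra.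
have [r r0 rk] := nth_root_exists k0 c0.
exists (t0 * r); first by rewrite mulf_neq0 // gt_eqF.
rewrite exprMn rk -mulrA divfK //.
by apply: contraTneq c0 => ->; rewrite invr0 mulr0 ltxx.
Qed.

(** * Binary forms *)

Lemma lift0_ord2 : lift ord0 ord0 = 1 :> 'I_2.
Proof. exact: val_inj. Qed.

Section BinaryForms.
Variable R : realType.
Implicit Types (Q : {mpoly R[2]}) (x y t u lam : R).

Lemma eval2E Q (x y : R) :
  eval2 Q x y = \sum_(m <- msupp Q) Q@_m * (x ^+ m 0 * y ^+ m 1).
Proof.
rewrite /eval2 mevalE; apply: eq_bigr => m _.
by rewrite big_ord_recl big_ord1 lift0_ord2.
Qed.

Lemma eval2_homog n Q (t x y : R) : Q \is n.-homog ->
  eval2 Q (t * x) (t * y) = t ^+ n * eval2 Q x y.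
Proof.
move=> /dhomogP Qn; rewrite !eval2E mulr_sumr; apply: eq_big_seq => m /Qn /=.
rewrite mdegE big_ord_recl big_ord1 lift0_ord2 => <-; rewrite exprD !exprMn.
ring.
Qed.

(** The composition of [Q] with the polynomial curve [u |-> (a, b)]; taking
    [(1, 'X)] or [('X, 1)] gives the two dehomogenizations of [Q]. *)
Definition slice (a b : {poly R}) Q : {poly R} :=
  mmap (@polyC R) (fun i : 'I_2 => if i == 0 then a else b) Q.

Lemma sliceE (a b : {poly R}) Q :
  slice a b Q = \sum_(m <- msupp Q) (Q@_m)%:P * (a ^+ m 0 * b ^+ m 1).
Proof.
rewrite /slice /mmap; apply: eq_bigr => m _.
by rewrite /mmap1 big_ord_recl big_ord1 lift0_ord2.
Qed.

Lemma horner_slice (a b : {poly R}) Q u : (slice a b Q).[u] = eval2 Q a.[u] b.[u].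
Proof.
rewrite sliceE eval2E horner_sum; apply: eq_bigr => m _.
by rewrite !hornerE.
Qed.

(** Among the monomials of degree [n], the exponent of the second variable
    determines the monomial, so dehomogenizing merges no coefficients. *)
Lemma dehomogenize_eq0 n Q : Q \is n.-homog -> slice 1 'X Q = 0 -> Q = 0.
Proof.
move=> Qn Q0; apply/mpolyP => m; rewrite mcoeff0.
have [mQ|] := boolP (m \in msupp Q); last exact: memN_msupp_eq0.
have /dhomogP Qdeg := Qn.
have mdegQ m' : m' \in msupp Q -> (m' 0%R + m' 1%R)%N = n.
  by move=> /Qdeg /=; rewrite mdegE big_ord_recl big_ord1 lift0_ord2.
have : (slice 1 'X Q)`_(m 1) = 0 by rewrite Q0 coef0.
rewrite sliceE coef_sum (bigD1_seq m) ?msupp_uniq //=.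
rewrite expr1n mul1r coefCM coefXn eqxx mulr1.
rewrite big_seq_cond big1 ?addr0 // => m' /andP[m'Q m'm].
rewrite expr1n mul1r coefCM coefXn; case: eqP => [m1|]; last by rewrite mulr0.
case/eqP: m'm; apply/mnmP => i; case: i => -[|[|//]] lti.
- rewrite (_ : Ordinal lti = 0); last exact: val_inj.
  by apply/eqP; rewrite -(eqn_add2r (m 1%R)) {1}m1 !mdegQ.
- by rewrite (_ : Ordinal lti = 1) //; exact: val_inj.
Qed.

(** * Equilibria at infinity *)

Definition crossform (Q1 Q2 : {mpoly R[2]}) : {mpoly R[2]} :=
  'X_1 * Q1 - 'X_0 * Q2.

Lemma crossform_homog n Q1 Q2 : Q1 \is n.-homog -> Q2 \is n.-homog ->
  crossform Q1 Q2 \is n.+1.-homog.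
Proof.
move=> Q1n Q2n; rewrite /crossform -[n.+1]add1n.
by apply: rpredB; apply: dhomogM => //; rewrite dhomogX /= mdeg1.
Qed.

Lemma eval2_crossform Q1 Q2 x y :
  eval2 (crossform Q1 Q2) x y = y * eval2 Q1 x y - x * eval2 Q2 x y.
Proof. by rewrite /eval2 /crossform mevalB !mevalM !mevalXU. Qed.

Lemma poincare_F_eq0 n Q1 Q2 x y :
  Q1 \is n.-homog -> Q2 \is n.-homog -> x != 0 ->
  (poincare_F Q1 Q2 (y / x) == 0) = (eval2 (crossform Q1 Q2) x y == 0).
Proof.
move=> Q1n Q2n x0; have Wn := crossform_homog Q1n Q2n.
have -> : eval2 (crossform Q1 Q2) x y
    = eval2 (crossform Q1 Q2) (x * 1) (x * (y / x)).
  by rewrite mulr1 mulrCA divff // mulr1.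
rewrite (eval2_homog _ _ _ Wn) eval2_crossform mul1r mulf_eq0 expf_eq0.
by rewrite (negPf x0) andbF /= -opprB oppr_eq0.
Qed.

Lemma poincare_G_eq0 n Q1 Q2 x y :
  Q1 \is n.-homog -> Q2 \is n.-homog -> y != 0 ->
  (poincare_G Q1 Q2 (x / y) == 0) = (eval2 (crossform Q1 Q2) x y == 0).
Proof.
move=> Q1n Q2n y0; have Wn := crossform_homog Q1n Q2n.
have -> : eval2 (crossform Q1 Q2) x y
    = eval2 (crossform Q1 Q2) (y * (x / y)) (y * 1).
  by rewrite mulr1 mulrCA divff // mulr1.
rewrite (eval2_homog _ _ _ Wn) eval2_crossform mul1r mulf_eq0 expf_eq0.
by rewrite (negPf y0) andbF.
Qed.

(** On [v = 0] the second component of every chart field vanishes, and the first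
    one is a nonzero multiple of [F] or [G], so each chart sees the zeros of
    the same form. *)
Lemma equilibria_at_infinityE lam n Q1 Q2 : (0 < n)%N ->
  Q1 \is n.-homog -> Q2 \is n.-homog ->
  equilibria_at_infinity lam n Q1 Q2 =
  [set z | circle_at_infinity z /\ eval2 (crossform Q1 Q2) z.1.1 z.1.2 = 0].
Proof.
move=> n0 Q1n Q2n; apply/seteqP; split=> -[[a b] c] [zC] /= zE; split => //;
  case: (zC) => zS /= c0; subst c.
- have s0 : (-1) ^+ n.-1 != 0 :> R by rewrite signr_eq0.
  apply/eqP; case: (ltgtP a 0) => [an|ap|a0].
  + have [/eqP + _] := zE V1 (conj zS an).
    by rewrite /= mulf_eq0 (negPf s0) /= (poincare_F_eq0 _ Q1n) // lt_eqF.
  + have [/eqP + _] := zE U1 (conj zS ap).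
    by rewrite /= (poincare_F_eq0 _ Q1n) // gt_eqF.
  case: (ltgtP b 0) => [bn|bp|b0].
  + have [/eqP + _] := zE V2 (conj zS bn).
    by rewrite /= mulf_eq0 (negPf s0) /= (poincare_G_eq0 _ Q1n) // lt_eqF.
  + have [/eqP + _] := zE U2 (conj zS bp).
    by rewrite /= (poincare_G_eq0 _ Q1n) // gt_eqF.
  + move: zS; rewrite /sphere /= a0 b0 expr0n /= !addr0 => /esym/eqP.
    by rewrite oner_eq0.
- move/eqP: zE => zE.
  have infty (r d : R) : - lam * (0 / r) ^+ n - 0 / r * d = 0.
    by rewrite mul0r expr0n gtn_eqF //= mulr0 mul0r subr0.
  case=> -[_ /= ab]; rewrite /equilibria /= infty ?mulr0; congr pair;
    apply/eqP; rewrite ?mulf_eq0.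
  + by rewrite (poincare_F_eq0 _ Q1n) // gt_eqF.
  + by rewrite (poincare_G_eq0 _ Q1n) // gt_eqF.
  + by rewrite (poincare_F_eq0 _ Q1n) ?zE ?orbT // lt_eqF.
  + by rewrite (poincare_G_eq0 _ Q1n) ?zE ?orbT // lt_eqF.
Qed.

(** The line of slope [b / a] has only two unit vectors, and the sign of the
    first coordinate tells which one. *)
Lemma unit_vector_of_slope (a b : R) :
  a ^+ 2 + b ^+ 2 = 1 -> a != 0 ->
  a = Num.sg a / Num.sqrt (1 + (b / a) ^+ 2).
Proof.
move=> ab a0.
have -> : 1 + (b / a) ^+ 2 = (a ^+ 2 + b ^+ 2) * a^-1 ^+ 2 by field.
by rewrite ab mul1r sqrtr_sqr normfV invrK -numEsg.
Qed.

(** A zero off the y-axis has as slope a root of the dehomogenization of [W],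
    and there are two unit vectors of each slope; only the two points of the
    circle on the y-axis escape this count. *)
Lemma finite_circle_zeros n (W : {mpoly R[2]}) : W \is n.-homog -> W != 0 ->
  finite_set
    [set z : R * R * R | circle_at_infinity z /\ eval2 W z.1.1 z.1.2 = 0].
Proof.
move=> Wn W0; set p := slice 1 'X W.
have p0 : p != 0 by apply: contra_neq W0; exact: dehomogenize_eq0 Wn.
pose on_line (v : R * R) : R * R * R :=
  (v.1 / Num.sqrt (1 + v.2 ^+ 2), v.2 * (v.1 / Num.sqrt (1 + v.2 ^+ 2)), 0).
pose A := [set (1 : R); -1] `*` [set` rootsR p].
have fin : finite_set (on_line @` A `|` [set (0, 1, 0); (0, -1, 0)]).
  by rewrite finite_setU; split => //; apply/finite_image/finite_setX.
apply: sub_finite_set fin => -[[a b] c] [[zS /= c0] /= Wab].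
have ab : a ^+ 2 + b ^+ 2 = 1 by move: zS; rewrite /sphere /= c0 expr0n addr0.
rewrite c0.
have [a0|a0] := eqVneq a 0; [right|left].
  move/eqP: ab; rewrite a0 expr0n add0r sqrf_eq1 => /orP[]/eqP ->; by [left|right].
have aE := unit_vector_of_slope ab a0.
exists (Num.sg a, b / a); last by rewrite /on_line /= -aE divfK.
split => /=.
  by move: a0; case: sgrP; [|left|right].
rewrite -(roots_on_rootsR p0) in_itv /= /root /p horner_slice hornerC hornerX.
have : a ^+ n * eval2 W 1 (b / a) == 0.
  by rewrite -(eval2_homog _ _ _ Wn) mulr1 mulrCA divff // mulr1 Wab.
by rewrite mulf_eq0 expf_eq0 (negPf a0) andbF.
Qed.

(** Every slope is taken on the circle. *)
Lemma infinite_circle : infinite_set (@circle_at_infinity R).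
Proof.
apply: (@infinite_sub_image _ _ (fun z : R * R * R => z.1.2 / z.1.1) _ setT);
  last exact: infinite_realType.
move=> u _; set r := Num.sqrt (1 + u ^+ 2).
have u0 : 0 < 1 + u ^+ 2 by rewrite ltr_pwDl ?sqr_ge0.
have r0 : r != 0 by rewrite gt_eqF // sqrtr_gt0.
exists (r^-1, u / r, 0) => /=; last by field.
split => //=; rewrite /sphere /= expr0n addr0.
have -> : r^-1 ^+ 2 + (u / r) ^+ 2 = (1 + u ^+ 2) / r ^+ 2 by field.
by rewrite sqr_sqrtr ?ltW // divff // gt_eqF.
Qed.

(** * Finite equilibria of a radial field *)

(** Stated for functions rather than for [eval2 Q1] and [eval2 Q2], so that it
    also applies after exchanging the two coordinates.  Equilibria on different
    lines through the origin are different, so it suffices to find one on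
    infinitely many lines. *)
Lemma infinite_radial_equilibria lam n (f g : R -> R -> R) (q : {poly R})
    (x y : R) :
  (1 < n)%N -> lam != 0 ->
  (forall t a b, f (t * a) (t * b) = t ^+ n * f a b) ->
  (forall t a b, g (t * a) (t * b) = t ^+ n * g a b) ->
  (forall a b, b * f a b = a * g a b) -> (forall u, f 1 u = q.[u]) ->
  x != 0 -> lam * x + f x y = 0 ->
  infinite_set [set z : R * R | lam * z.1 + f z.1 z.2 = 0
                             /\ lam * z.2 + g z.1 z.2 = 0].
Proof.
case: n => // n n1 lam0 fn gn fg fq x0 eq1.
have fray t u : f t (t * u) = t ^+ n.+1 * q.[u].
  by rewrite -fq -fn mulr1.
have gray t u : g t (t * u) = t ^+ n.+1 * (u * q.[u]).
  by rewrite -fq fg mul1r -gn mulr1.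
have eq0 : lam + x ^+ n * q.[y / x] = 0.
  apply: (mulfI x0); rewrite mulr0 -eq1.
  rewrite [in RHS](_ : y = x * (y / x)); last by rewrite mulrCA divff // mulr1.
  by rewrite fray exprS; ring.
have := infinite_ray_directions n1 lam0 eq0.
apply: (@infinite_sub_image _ _ (fun z : R * R => z.2 / z.1)).
move=> u [t t0 tu]; exists (t, t * u) => /=; last by rewrite mulrC mulKf.
have ray c : lam * (t * c) + t ^+ n.+1 * (c * q.[u]) = 0.
  transitivity (t * c * (lam + t ^+ n * q.[u])); last by rewrite tu mulr0.
  by rewrite exprS; ring.
by rewrite fray gray; split; [have := ray 1; rewrite mulr1 mul1r | exact: ray].
Qed.

Lemma infinite_equilibria_of_nonzero lam n Q1 Q2 (x y : R) :
  (1 < n)%N -> lam != 0 ->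
  Q1 \is n.-homog -> Q2 \is n.-homog -> crossform Q1 Q2 = 0 ->
  equilibria (hsystem lam Q1 Q2) (x, y) -> (x, y) != (0, 0) ->
  infinite_set (equilibria (hsystem lam Q1 Q2)).
Proof.
move=> n1 lam0 Q1n Q2n W0 [/= eq1 eq2] xy0.
have cross a b : b * eval2 Q1 a b = a * eval2 Q2 a b.
  have := eval2_crossform Q1 Q2 a b; rewrite W0 /eval2 meval0.
  by move/esym/eqP; rewrite subr_eq0 => /eqP.
have slice1 u : eval2 Q1 1 u = (slice 1 'X Q1).[u].
  by rewrite horner_slice hornerC hornerX.
have slice2 u : eval2 Q2 u 1 = (slice 'X 1 Q2).[u].
  by rewrite horner_slice hornerC hornerX.
have [xE|x0] := eqVneq x 0; last first.
  have inf := infinite_radial_equilibria n1 lam0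
    (fun t a b => eval2_homog t a b Q1n) (fun t a b => eval2_homog t a b Q2n)
    cross slice1 x0 eq1.
  by apply: (sub_infinite_set _ inf) => -[a b] /= [? ?]; congr pair.
have y0 : y != 0 by apply: contraNneq xy0 => ->; rewrite xE.
have inf := infinite_radial_equilibria (f := fun a b => eval2 Q2 b a)
  (g := fun a b => eval2 Q1 b a) n1 lam0
  (fun t a b => eval2_homog t b a Q2n) (fun t a b => eval2_homog t b a Q1n)
  (fun a b => esym (cross b a)) slice2 y0 eq2.
apply: (@infinite_sub_image _ _ (fun z : R * R => (z.2, z.1))) inf.
by move=> [a b] /= [ea eb]; exists (b, a) => //; congr pair.
Qed.
End BinaryForms.

Theorem lemma3p1 (R : realType) (lam : R) (n : nat) (Q1 Q2 : {mpoly R[2]})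
    (hlam : lam != 0) (hn : (1 < n)%N)
    (hQ1 : Q1 != 0) (hQ2 : Q2 != 0)
    (hQ1n : Q1 \is n.-homog) (hQ2n : Q2 \is n.-homog) :
  (infinite_set (equilibria_at_infinity lam n Q1 Q2) <->
   'X_1 * Q1 = 'X_0 * Q2) /\
  ('X_1 * Q1 = 'X_0 * Q2 ->
   infinite_set (equilibria (hsystem lam Q1 Q2)) \/
   equilibria (hsystem lam Q1 Q2) = [set (0, 0)]).
Proof.
have n0 : (0 < n)%N by apply: ltnW.
have crossP : 'X_1 * Q1 = 'X_0 * Q2 <-> crossform Q1 Q2 = 0.
  rewrite /crossform; split=> [->|/eqP]; first by rewrite subrr.
  by rewrite subr_eq0 => /eqP.
rewrite crossP equilibria_at_infinityE //; split; first split.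
- move=> inf; apply: contrapT => /eqP W0; apply: inf.
  exact: finite_circle_zeros (crossform_homog hQ1n hQ2n) W0.
- move=> W0; apply: (sub_infinite_set _ (@infinite_circle R)) => z zC.
  by split => //; rewrite W0 /eval2 meval0.
move=> W0.
have [[[x y] [xyE xy0]]|none] :=
    pselect (exists z, equilibria (hsystem lam Q1 Q2) z /\ z != (0, 0)).
  by left; exact: infinite_equilibria_of_nonzero hn hlam hQ1n hQ2n W0 xyE xy0.
right; apply/seteqP; split=> [z zE|z ->] /=.
  by apply: contrapT => /eqP z0; apply: none; exists z.
have eval0 Q : Q \is n.-homog -> eval2 Q 0 0 = 0 :> R.
  move=> Qn; have := eval2_homog 0 0 0 Qn.
  by rewrite !mul0r expr0n gtn_eqF // mul0r.
by rewrite /equilibria /hsystem /= !eval0 // mulr0 addr0.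
Qed.
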